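(* Let $n\ge 1$. A vector $p=(p_T)_{\emptyset\neq T\subseteq\{1,\ldots,n\}}\in\mathbb R^{2^n-1}$ belongs to the complete probability polytope $\mathcal{CP}_n$ if and only if, with the convention $p_\emptyset=1$, its components satisfy the $2^n$ inequalities $$\sum_{S\subseteq T\subseteq\{1,\ldots,n\}}(-1)^{|T\setminus S|}\,p_T\;\ge\;0\qquad\text{for every } S\subseteq\{1,\ldots,n\}.$$
   Context: The complete probability polytope $\mathcal{CP}_n\subset\mathbb R^{2^n-1}$ has coordinates indexed by the nonempty subsets $T\subseteq\{1,\ldots,n\}$ (the coordinate $p_T$ with $T=\{i_1,\ldots,i_k\}$ is also written $p_{i_1\ldots i_k}$). It is the convex hull of the $2^n$ vectors $u_\varepsilon$, $\varepsilon=(\varepsilon_1,\ldots,\varepsilon_n)\in\{0,1\}^n$, where $(u_\varepsilon)_T=\prod_{i\in T}\varepsilon_i$. *)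

(* Defs.v *)
From HB Require Import structures.
From mathcomp Require Import all_boot all_order all_algebra.
From mathcomp Require Import classical_sets reals convex.

Set Implicit Arguments.
Unset Strict Implicit.
Unset Printing Implicit Defensive.

Import Order.TTheory GRing.Theory Num.Theory.

Local Open Scope classical_set_scope.
Local Open Scope ring_scope.

Definition convex_hull (R : numDomainType) (M : lmodType R) (A : set M)
  : set M := smallest (@convex_set R M) A.

(* The ground set {1, ..., n} is represented by 'I_n = {0, ..., n - 1}. *)
Notation nonempty_subset n := {T : {set 'I_n} | T != finset.set0}.

(* R^(2^n - 1); the regular module R^o (convertible to R) supplies the
   lmodType structure. *)
Notation prob_vector R n := {ffun nonempty_subset n -> R^o}.

Definition vertex (R : realType) (n : nat) (eps : {ffun 'I_n -> bool})
  : prob_vector R n :=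
  [ffun T : nonempty_subset n => \prod_(i in val T) (eps i)%:R : R^o].

Definition complete_probability_polytope (R : realType) (n : nat)
  : set (prob_vector R n) := convex_hull (range (@vertex R n)).

Arguments complete_probability_polytope : clear implicits.

(* insub T is None exactly when T is empty, so this is the convention that the
   coordinate at the empty set equals 1. *)
Definition coord1 (R : realType) (n : nat) (p : prob_vector R n)
  (T : {set 'I_n}) : R := oapp p 1 (insub T).

Lemma coord1_set0 (R : realType) (n : nat) (p : prob_vector R n) :
  coord1 p finset.set0 = 1.
Proof. by rewrite /coord1 insubF //= eqxx. Qed.

Lemma coord1_val (R : realType) (n : nat) (p : prob_vector R n)
  (T : nonempty_subset n) : coord1 p (val T) = p T.
Proof. by rewrite /coord1 valK. Qed.

(* Main.v *)
(* The left-hand side of the inequality at S is the Moebius transform mu_S of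
   T |-> p_T on the Boolean lattice, ordered by reverse inclusion. It is affine
   in p and takes the value [S = supp eps] at the vertex u_eps, so it is
   nonnegative on the hull. Conversely, Moebius inversion reads p as the sum of
   the mu_S(p) u_(1_S), and its instance T = set0 says that these coefficients
   sum to p_set0 = 1. *)
Require Import Defs.
From mathcomp Require Import all_boot all_order all_algebra.
From mathcomp Require Import interval_inference.
From mathcomp Require Import classical_sets reals convex.

Set Implicit Arguments.
Unset Strict Implicit.
Unset Printing Implicit Defensive.

Import Order.TTheory GRing.Theory Num.Theory.

Local Open Scope ring_scope.

(** The relation $\mu * \zeta = \delta$ in the incidence algebra of the Boolean lattice, where
    $\mu(S,T) = (-1)^{|T \setminus S|}$. *)
Lemma sum_sign_interval (R : pzRingType) (I : finType) (S E : {set I}) :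
  \sum_(T : {set I} | (S \subset T) && (T \subset E)) (-1) ^+ #|T :\: S|
    = (S == E)%:R :> R.
Proof.
have [<-|neqSE] := eqVneq S E.
  rewrite (big_pred1 S) ?finset.setDv ?cards0 ?expr0// => T.
  by rewrite /= finset.eqEsubset andbC.
have [subSE|nsubSE] := boolP (S \subset E); last first.
  by rewrite big1// => T /andP[ST /(fintype.subset_trans ST)]; rewrite (negPf nsubSE).
have /subsetPn[x xE xS] : ~~ (E \subset S).
  by apply: contra neqSE => ES; rewrite finset.eqEsubset subSE.
(* T |-> x |: T pairs off the terms, with opposite signs. *)
rewrite (bigID (fun T : {set I} => x \in T)) /=.
rewrite (reindex_onto (fun T => x |: T) (fun T => T :\ x)) /=; last first.
  by move=> T /andP[_ xT]; rewrite finset.setD1K.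
(* Adding [x] to [T] affects neither inclusion, since [x] lies in [E] but not in [S]; the round-trip
   condition left by the reindexing amounts to [x \notin T]. *)
rewrite (eq_bigl (fun T : {set I} =>
    (S \subset T) && (T \subset E) && (x \notin T))); last first.
  move=> T; rewrite finset.setU11 andbT finset.subUset finset.sub1set xE /=.
  have [xT|xT] := boolP (x \in T).
    rewrite andbF; apply/negbTE/negP => /andP[_ /eqP eqT].
    by move: xT; rewrite -eqT finset.setD11.
  rewrite finset.setU1K// eqxx !andbT; congr (_ && _).
  by rewrite -subDset finset.setDE (finset.setIidPl _)// finset.subsetC finset.sub1set inE.
rewrite -big_split big1//= => T /andP[_ xT].
have -> : (x |: T) :\: S = x |: (T :\: S).
  by apply/setP => y; rewrite !inE; case: eqP => [->|]; rewrite ?xS.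
by rewrite cardsU1 !inE xS (negPf xT) /= exprS mulN1r addNr.
Qed.

(** The companion relation $\zeta * \mu = \delta$. It reduces to the first because $|E \setminus S|
    = |E \setminus T| + |T \setminus S|$ on the interval, so the two signs differ by a constant
    factor. *)
Lemma sum_sign_interval_compl (R : pzRingType) (I : finType) (S E : {set I}) :
  \sum_(T : {set I} | (S \subset T) && (T \subset E)) (-1) ^+ #|E :\: T|
    = (S == E)%:R :> R.
Proof.
rewrite (eq_bigr (fun T => (-1) ^+ #|E :\: S| * (-1) ^+ #|T :\: S|)); last first.
  move=> T /andP[ST TE]; rewrite !cardsDS// ?(fintype.subset_trans ST)//.
  rewrite -[in X in _ = X * _](subnK (subset_leq_card TE)).
  by rewrite -addnBA ?subset_leq_card// exprD -mulrA -expr2 sqrr_sign mulr1.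
rewrite -big_distrr /= sum_sign_interval; case: eqP => [->|_].
  by rewrite finset.setDv cards0 mulr1.
by rewrite mulr0.
Qed.

Definition moebius (R : pzRingType) (I : finType) (f : {set I} -> R)
    (S : {set I}) : R :=
  \sum_(T : {set I} | S \subset T) (-1) ^+ #|T :\: S| * f T.

(** After exchanging the sums, [f U] has as coefficient the alternating sum over the interval from
    [T] to [U], which vanishes unless [U = T]. *)
Lemma moebius_inversion (R : pzRingType) (I : finType) (f : {set I} -> R)
    (T : {set I}) :
  \sum_(S : {set I} | T \subset S) moebius f S = f T.
Proof.
rewrite /moebius (exchange_big_dep (fun U : {set I} => T \subset U)) /=; last first.
  by move=> S U; apply: fintype.subset_trans.
under eq_bigr do rewrite -big_distrl /= sum_sign_interval_compl.
rewrite (bigD1 T)//= eqxx mul1r big1 ?addr0// => U /andP[_ /negPf].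
by rewrite eq_sym => ->; rewrite mul0r.
Qed.

(** Convexity concerns two points only, so the first point is split off and the other weights are
    rescaled by [1 - w i] for the induction. *)
Lemma convex_set_sum (R : numFieldType) (M : lmodType R)
    (A : set (convex_lmodType M)) (I : Type) (s : seq I) (w : I -> R)
    (x : I -> M) :
  convex_set A -> (forall i, 0 <= w i) -> (forall i, A (x i)) ->
  \sum_(i <- s) w i = 1 -> A (\sum_(i <- s) w i *: x i).
Proof.
move=> cA + Ax; elim: s w => [|i s IHs] w w0.
  by rewrite big_nil => /esym/eqP; rewrite oner_eq0.
rewrite !big_cons => w1.
have ws0 : 0 <= \sum_(j <- s) w j by apply: sumr_ge0.
have wi1 : w i <= 1 by rewrite -w1 lerDl.
have wsE : \sum_(j <- s) w j = 1 - w i by rewrite -w1 addrC addKr.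
(* If the remaining weight is zero, rescaling is impossible; but then each remaining weight is zero
   and the sum is just [x i]. *)
have [ws_eq0|ws_neq0] := eqVneq (\sum_(j <- s) w j) 0.
  have wi : w i = 1 by move: w1; rewrite ws_eq0 addr0.
  have -> : \sum_(j <- s) w j *: x j = 0.
    elim: s ws_eq0 {IHs w1 ws0 wsE} => [|j s IHs]; first by rewrite !big_nil.
    rewrite !big_cons => /eqP.
    rewrite paddr_eq0 ?sumr_ge0// => /andP[/eqP -> /eqP/IHs ->].
    by rewrite scale0r addr0.
  by rewrite addr0 wi scale1r.
have As : A (\sum_(j <- s) (w j / (1 - w i)) *: x j).
  apply: IHs; last by rewrite -big_distrl /= wsE divff// -wsE.
  by move=> j; rewrite divr_ge0// -wsE.
have := cA _ _ (Itv01 (w0 i) wi1) (mem_set (Ax i)) (mem_set As).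
rewrite inE; congr (A _); congr (_ + _).
rewrite /= scaler_sumr; apply: eq_bigr => j _.
by rewrite scalerA /unstable.onem mulrCA divff ?mulr1// -wsE.
Qed.

Section ProbabilityVectors.
Variables (R : realType) (n : nat).
Implicit Types (p q : prob_vector R n) (S T : {set 'I_n}).

(** At the empty set the constant 1 is preserved because the two weights sum to 1. *)
Lemma coord1_conv (t : {i01 R}) p q T :
  coord1 (conv t (p : convex_lmodType _) (q : convex_lmodType _)) T
    = t%:num * coord1 p T + (1 - t%:num) * coord1 q T.
Proof.
rewrite /coord1; case: insubP => [u _ _|_] /=; last first.
  by rewrite !mulr1 addrC subrK.
by rewrite !ffunE.
Qed.

Lemma moebius_conv (t : {i01 R}) p q S :
  moebius (coord1 (conv t (p : convex_lmodType _) (q : convex_lmodType _))) S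
    = t%:num * moebius (coord1 p) S + (1 - t%:num) * moebius (coord1 q) S.
Proof.
rewrite /moebius !big_distrr -big_split; apply: eq_bigr => T _ /=.
by rewrite coord1_conv mulrDr !(mulrCA _ ((-1) ^+ _)).
Qed.

Lemma coord1_vertex (eps : {ffun 'I_n -> bool}) T :
  coord1 (vertex R eps) T = (T \subset [set i | eps i])%:R.
Proof.
(* The convention at the empty set agrees with the empty product, so one formula covers every
   [T]. *)
have -> : coord1 (vertex R eps) T = \prod_(i in T) (eps i)%:R.
  rewrite /coord1; case: insubP => [u _ <-|/negPn/eqP ->] /=; last first.
    by rewrite big_set0.
  by rewrite ffunE.
have [/fintype.subsetP sub|/subsetPn[i iT]] := boolP (T \subset _).
  by rewrite big1// => i /sub; rewrite inE => ->.
by rewrite inE => /negPf epsi; rewrite (bigD1 i)//= epsi mul0r.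
Qed.

(** The coordinates of the vertex cut the sum down to the interval from [S] to the support of
    [eps]. *)
Lemma moebius_vertex (eps : {ffun 'I_n -> bool}) S :
  moebius (coord1 (vertex R eps)) S = (S == [set i | eps i])%:R.
Proof.
rewrite -sum_sign_interval /moebius big_mkcondr /=.
by apply: eq_bigr => T _; rewrite coord1_vertex; case: ifP; rewrite ?mulr1 ?mulr0.
Qed.

(** The vertex of [S] has coordinate 1 at [T] if [T] is contained in [S] and 0 otherwise, so each
    coordinate of the identity is an instance of Moebius inversion. *)
Lemma vertex_decomposition p :
  p = \sum_(S : {set 'I_n})
        moebius (coord1 p) S *: vertex R [ffun i => i \in S].
Proof.
apply/ffunP => T; rewrite sum_ffunE -coord1_val -moebius_inversion big_mkcond.
apply: eq_bigr => S _; rewrite !ffunE -[\prod_(_ in _) _]/(_ : R).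
have := coord1_vertex [ffun i => i \in S] (val T).
rewrite coord1_val ffunE => ->.
have -> : [set i | [ffun i => i \in S] i] = S by apply/setP => i; rewrite inE ffunE.
by case: ifP => _; rewrite /GRing.scale /= ?mulr1 ?mulr0.
Qed.

End ProbabilityVectors.

Theorem theorem8 (R : realType) (n : nat) (hn : (1 <= n)%N)
    (p : prob_vector R n) :
  complete_probability_polytope R n p <->
  (forall S : {set 'I_n},
     \sum_(T : {set 'I_n} | S \subset T)
        (-1) ^+ #|T :\: S| * coord1 p T >= 0).
Proof.
split=> [hp S|p_ge0].
  (* The hull lies in every convex set that contains the vertices, in particular in the half-space
     of the inequality at [S]. *)
  pose H := [set q : prob_vector R n | 0 <= moebius (coord1 q) S]%classic.
  apply: (hp H); split.
    move=> x y t; rewrite !inE /H /= => x0 y0.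
    by rewrite moebius_conv addr_ge0// mulr_ge0// subr_ge0.
  by move=> _ [eps _ <-]; rewrite /H /= moebius_vertex ler0n.
(* Here [A] is an arbitrary convex set containing the vertices; it must contain this convex
   combination of them. *)
rewrite (vertex_decomposition p) => A [cA vA].
apply: convex_set_sum => //; first by move=> S; apply: vA; exists [ffun i => i \in S].
rewrite -[RHS](coord1_set0 p) -moebius_inversion.
by apply: eq_bigl => S; rewrite finset.sub0set.
Qed.
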